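(* There exist positive absolute constants $c_1,c_2,c_3$ for which the following holds. Let $X$ be a random vector in $\mathbb{R}^n$, let $A>0$ and $\tau>0$, and assume that $(\mathbb{E}\|X\|_{\ell_2^n}^2)^{1/2}\le A\sqrt n$ and $Q(2\tau)>0$, where $$Q(u)=\inf_{t\in S^{n-1}}\mathbb{P}\{|\langle X,t\rangle|\ge u\}.$$ Let $X_1,\dots,X_N$ be independent copies of $X$ and let $\Gamma=\frac{1}{\sqrt N}\sum_{i=1}^N\langle X_i,\cdot\rangle e_i$. If $$N\ge c_1\frac{A^2n}{\tau^2Q^2(2\tau)},$$ then with probability at least $1-2\exp(-c_3NQ^2(2\tau))$, $$\lambda_{\min}(\Gamma)\ge c_2\,\tau\,Q^{1/2}(2\tau).$$
   Context: $S^{n-1}$ is the Euclidean unit sphere of $\mathbb{R}^n$ and $\langle\cdot,\cdot\rangle$ the standard inner product. $(e_i)_{i=1}^N$ is the canonical basis of $\mathbb{R}^N$, so $\Gamma$ is the $N\times n$ random matrix with rows $X_1/\sqrt N,\dots,X_N/\sqrt N$, and $\lambda_{\min}(\Gamma)=\inf_{t\in S^{n-1}}\|\Gamma t\|_{\ell_2^N}$ is its smallest singular value. *)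

(* Defs.v *)
From HB Require Import structures.
From mathcomp Require Import all_boot all_order all_algebra.
From mathcomp Require Import all_classical all_reals all_analysis.

Set Implicit Arguments.
Unset Strict Implicit.
Unset Printing Implicit Defensive.

Import Order.TTheory GRing.Theory Num.Theory.
Import numFieldNormedType.Exports.

Local Open Scope classical_set_scope.
Local Open Scope ring_scope.

Definition inner (R : realType) n (u v : 'cV[R]_n) : R :=
  \sum_(i < n) u i ord0 * v i ord0.

(* MathComp-Analysis equips matrices with the sup norm, hence this separate
   Euclidean norm. *)
Definition enorm (R : realType) n (u : 'cV[R]_n) : R := Num.sqrt (inner u u).

(* The sphere S^(n-1); it is empty for n = 0. *)
Definition unit_sphere (R : realType) n : set 'cV[R]_n := [set t | enorm t = 1].
Arguments unit_sphere {R} n _.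

Definition lambda_min (R : realType) N n (G : 'M[R]_(N, n)) : R :=
  inf [set enorm (G *m t) | t in unit_sphere n].

(* Random vectors take values in n.-tuple R, whose library sigma-algebra (the
   one generated by the coordinates) is the Borel sigma-algebra of R^n; vec
   transports them to the column vectors used for linear algebra. *)
Definition vec (R : realType) n (x : n.-tuple R) : 'cV[R]_n :=
  \col_(j < n) tnth x j.

Definition Gamma (R : realType) N n (x : 'I_N -> n.-tuple R) : 'M[R]_(N, n) :=
  \matrix_(i < N) ((Num.sqrt N%:R)^-1 *: (vec (x i))^T).

(* For n = 0 this is inf set0 = 0. *)
Definition Q (R : realType) d (T : measurableType d) (P : probability T R) n
    (X : {RV P >-> n.-tuple R}) (u : R) : R :=
  inf [set fine (P [set w | u <= `|inner (vec (X w)) t|])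
      | t in unit_sphere n].

Definition same_law (R : realType) d1 d2 d' (T1 : measurableType d1)
    (T2 : measurableType d2) (T' : measurableType d') (P1 : probability T1 R) (P2 : probability T2 R)
    (X1 : {RV P1 >-> T'}) (X2 : {RV P2 >-> T'}) : Prop :=
  forall B : set T', measurable B ->
    distribution P1 X1 B = distribution P2 X2 B.

Definition mutually_independent (R : realType) d d' (T : measurableType d)
    (T' : measurableType d') (P : probability T R) (I : finType)
    (X : I -> {RV P >-> T'}) : Prop :=
  forall (J : {set I}) (B : I -> set T'),
    (forall i, measurable (B i)) ->
    P (\bigcap_(i in [set` J]) (X i @^-1` B i))
    = (\prod_(i in J) P (X i @^-1` B i))%E.

(* The copies may live on another probability space than X. *)
Definition independent_copies (R : realType) d0 d d' (T0 : measurableType d0)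
    (T : measurableType d) (T' : measurableType d')
    (P0 : probability T0 R) (P : probability T R) (X : {RV P0 >-> T'})
    (I : finType) (Xs : I -> {RV P >-> T'}) : Prop :=
  mutually_independent Xs /\ forall i, same_law (Xs i) X.

(* Main.v *)
Require Import Defs.
From HB Require Import structures.
From mathcomp Require Import all_boot all_order all_algebra.
From mathcomp Require Import all_classical all_reals all_analysis.
From mathcomp Require Import measurable_realfun.
From mathcomp Require Import ring lra.

Import Order.TTheory GRing.Theory Num.Theory.
Import numFieldNormedType.Exports.

Local Open Scope classical_set_scope.
Local Open Scope ring_scope.

(** The proof is a union bound over one finite net, with no symmetrization and
    no concentration of suprema.

    Write q for Q(2 tau).  If every unit vector t has at least N q / 16 indices i
    with |<X_i, t>| >= tau, then |Gamma t|^2, the average of the <X_i, t>^2, is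
    at least tau^2 q / 16 ([lambda_min_ge]).  For a single vector whose norm is
    at least 3/4, more than N q / 4 of the margins |<X_i, .>| exceed 3 tau / 2
    outside an event of probability exp(-N q / 4) ([small_ball_le_prob] and
    [frequency_lower_tail]).  The point is to reach all t from a net whose
    cardinality is only exp(O(N q)).

    An ordinary epsilon-net would have to be so fine that |<X_i, t - theta>| is
    bounded by |X_i| |t - theta|, and the logarithm of its size would exceed n by
    a logarithmic factor.  Instead, t is rounded at random, coordinate by
    coordinate and without bias, to the lattice delta Z^n.  Then <X_i, theta - t>
    is a sum of n centered independent terms, so its mean square is at most
    delta^2 |X_i|^2 / 4, a gain of a factor n over the worst case, and the mesh
    delta may be of order tau sqrt(q) / (A sqrt n).  Hence some lattice point
    theta near t loses at most sum_i min(1, delta^2 |X_i|^2 / tau^2) margins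
    ([rounding_keeps_margins]).  That sum does not depend on t; its summands are
    independent, lie in [0, 1] and have mean at most q / 64 by the second moment
    assumption, so it is at most N q / 8 outside an event of probability
    exp(-N q / 64) ([truncated_mean_upper_tail]).

    The lattice points reached have l^1 norm (in units of delta) at most
    L = 4 / delta^2, because |k| <= k^2 for integers, and there are at most
    2^(2 n + L) of them ([card_lattice_net]).  Since 1 / delta^2 is
    64 A^2 n / (tau^2 q), the assumption on N makes the exponent a small multiple
    of N q, which the single-vector estimate absorbs.  Finally q <= 1 turns N q
    into N q^2.

    Both tail estimates come from one exponential Markov inequality for
    finite-valued functions of independent copies ([chernoff_iid]), where the
    joint law is a finite product and no integration over the product space is
    involved. *)

(** * Euclidean geometry *)

Lemma inner_ge0 (R : realType) n (u : 'cV[R]_n) : 0 <= inner u u.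
Proof. by apply: sumr_ge0 => j _; rewrite -expr2 sqr_ge0. Qed.

Lemma sqr_enorm (R : realType) n (u : 'cV[R]_n) : enorm u ^+ 2 = inner u u.
Proof. by rewrite sqr_sqrtr// inner_ge0. Qed.

Lemma innerDr (R : realType) n (u v w : 'cV[R]_n) :
  inner u (v + w) = inner u v + inner u w.
Proof.
by rewrite /inner -big_split/=; apply: eq_bigr => j _; rewrite mxE mulrDr.
Qed.

Lemma innerZr (R : realType) n (a : R) (u v : 'cV[R]_n) :
  inner u (a *: v) = a * inner u v.
Proof.
by rewrite /inner mulr_sumr; apply: eq_bigr => j _; rewrite mxE mulrCA.
Qed.

Lemma inner_scale (R : realType) n (a : R) (u : 'cV[R]_n) :
  inner (a *: u) (a *: u) = a ^+ 2 * inner u u.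
Proof.
by rewrite /inner mulr_sumr; apply: eq_bigr => j _; rewrite !mxE; ring.
Qed.

Lemma unit_sphere_delta (R : realType) n (j : 'I_n) :
  unit_sphere n (delta_mx j ord0 : 'cV[R]_n).
Proof.
rewrite /unit_sphere/= /enorm /inner (bigD1 j)//= big1 => [|i ij].
  by rewrite !mxE !eqxx mulr1 addr0 sqrtr1.
by rewrite !mxE (negbTE ij) mul0r.
Qed.

Lemma Gamma_mulmx (R : realType) n N (x : 'I_N -> n.-tuple R) (t : 'cV[R]_n) i :
  (Gamma x *m t) i ord0 = (Num.sqrt N%:R)^-1 * inner (vec (x i)) t.
Proof.
rewrite mxE /inner mulr_sumr; apply: eq_bigr => j _.
by rewrite !mxE mulrA.
Qed.

(** Each index with a margin of at least tau contributes at least tau^2 / N to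
    |Gamma t|^2. *)
Lemma lambda_min_ge (R : realType) n N (x : 'I_N -> n.-tuple R) (tau q : R) :
  (0 < n)%N -> (0 < N)%N -> 0 < tau -> 0 <= q ->
  (forall t : 'cV[R]_n, unit_sphere n t ->
    N%:R * q / 16 <= \sum_i (tau <= `|inner (vec (x i)) t|)%R%:R) ->
  4^-1 * tau * Num.sqrt q <= lambda_min (Gamma x).
Proof.
move=> n0 N0 tau0 q0 xq.
apply: lb_le_inf.
  exists (enorm (Gamma x *m delta_mx (Ordinal n0) ord0)).
  exists (delta_mx (Ordinal n0) ord0) => //; exact: unit_sphere_delta.
move=> _ /= [t t1 <-].
have NR0 : 0 < N%:R :> R by rewrite ltr0n.
have lhs0 : 0 <= 4^-1 * tau * Num.sqrt q.
  by rewrite !mulr_ge0 ?sqrtr_ge0 ?invr_ge0// ltW.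
rewrite -ler_sqr ?nnegrE ?sqrtr_ge0// sqr_enorm.
rewrite !exprMn sqr_sqrtr//.
have -> : inner (Gamma x *m t) (Gamma x *m t)
    = N%:R^-1 * \sum_i inner (vec (x i)) t ^+ 2.
  rewrite mulr_sumr; apply: eq_bigr => i _.
  by rewrite Gamma_mulmx -expr2 exprMn exprVn sqr_sqrtr// ltW.
rewrite ler_pdivlMl//.
apply: (@le_trans _ _ (tau ^+ 2 * \sum_i (tau <= `|inner (vec (x i)) t|)%R%:R)).
  have -> : N%:R * (4^-1 ^+ 2 * tau ^+ 2 * q) = tau ^+ 2 * (N%:R * q / 16) :> R.
    by field.
  by rewrite ler_pM2l ?exprn_gt0// xq.
rewrite mulr_sumr; apply: ler_sum => i _.
case: (leP tau) => [h|_]; last by rewrite mulr0 sqr_ge0.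
rewrite mulr1 -(real_normK (num_real (inner (vec (x i)) t))).
by rewrite ler_sqr ?nnegrE ?(ltW tau0).
Qed.

(** * Unbiased rounding to a lattice *)

(** One-coordinate step.  Round t down with probability p and up with
    probability 1 - p, so that the error s is centered: the cross terms in y and s
    then vanish on average, and s has variance d^2 p (1 - p) <= d^2 / 4.  One of
    the two choices is at least as good as the average. *)
Lemma exists_good_rounding (R : realType) (I : finType) (y x : I -> R) (t d : R) :
  0 < d -> exists k : int, `|d * k%:~R - t| <= d /\
    \sum_i (y i + x i * (d * k%:~R - t)) ^+ 2
      <= \sum_i y i ^+ 2 + d ^+ 2 / 4 * \sum_i x i ^+ 2.
Proof.
move=> d0.
pose C := \sum_i y i * x i.
pose V := \sum_i x i ^+ 2.
have V0 : 0 <= V by apply: sumr_ge0 => i _; exact: sqr_ge0.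
have expand s : \sum_i (y i + x i * s) ^+ 2
    = \sum_i y i ^+ 2 + (2 * s * C + s ^+ 2 * V).
  rewrite /C /V !mulr_sumr -!big_split /=; apply: eq_bigr => i _; ring.
pose k := Num.floor (t / d); pose a := d * k%:~R - t.
have a_le0 : a <= 0.
  by rewrite subr_le0 mulrC -ler_pdivlMr// floor_le_tmp.
have a_gtNd : - d < a.
  rewrite /a; have := floorD1_gt (t / d); rewrite -/k ltr_pdivrMr//.
  by rewrite intrD mulrDl mul1r mulrC; lra.
have aE : d * (k + 1)%:~R - t = a + d by rewrite intrD /a; ring.
have [le_a|gt_a] := leP (2 * a * C + a ^+ 2 * V) (d ^+ 2 / 4 * V).
  exists k; rewrite -/a; split; first by rewrite ler_norml; lra.
  by rewrite expand lerD2l.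
(* If both errors a and a + d were bad, the combination with weights a + d
   and - a would cancel the cross term and contradict - a (a + d) <= d^2 / 4. *)
exists (k + 1); rewrite aE; split; first by rewrite ler_norml; lra.
rewrite expand lerD2l leNgt; apply/negP => gt_b.
have hda : (a + d) * (d ^+ 2 / 4 * V) < (a + d) * (2 * a * C + a ^+ 2 * V).
  by rewrite ltr_pM2l//; lra.
have hb : (- a) * (d ^+ 2 / 4 * V)
    <= (- a) * (2 * (a + d) * C + (a + d) ^+ 2 * V).
  by apply: ler_wpM2l; [lra | exact: ltW].
have := ltr_leD hda hb.
have sq : 0 <= d * V * (a + d / 2) ^+ 2.
  by rewrite mulr_ge0 ?sqr_ge0// mulr_ge0// ltW.
nra.
Qed.

(** Derandomized unbiased rounding: fixing the coordinates one at a time, the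
    errors add up in mean square as if they were independent. *)
Lemma exists_good_rounding_vector (R : realType) (I J : finType)
    (x : I -> J -> R) (t : J -> R) (d : R) : 0 < d ->
  exists k : J -> int, (forall j, `|d * (k j)%:~R - t j| <= d) /\
    \sum_i (\sum_j x i j * (d * (k j)%:~R - t j)) ^+ 2
      <= d ^+ 2 / 4 * \sum_i \sum_j x i j ^+ 2.
Proof.
move=> d0.
suff [k [kt kx]] : exists k : J -> int,
    (forall j, `|d * (k j)%:~R - t j| <= d) /\
    \sum_i (\sum_(j <- index_enum J) x i j * (d * (k j)%:~R - t j)) ^+ 2
      <= d ^+ 2 / 4 * \sum_i \sum_(j <- index_enum J) x i j ^+ 2.
  by exists k.
elim: (index_enum J) (index_enum_uniq J) => [_|j s IHs /= /andP[js us]].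
  have round0 j : exists k : int, `|d * k%:~R - t j| <= d.
    by have [k [kd _]] :=
      exists_good_rounding R I (fun=> 0) (fun=> 0) (t j) d d0; exists k.
  exists (fun j => sval (cid (round0 j))); split => [j|].
    exact: svalP (cid (round0 j)).
  by rewrite !big1 ?mulr0// => i _; rewrite big_nil ?expr0n.
have [k [kt kx]] := IHs us.
have [m [mt mx]] := exists_good_rounding R I
  (fun i => \sum_(j <- s) x i j * (d * (k j)%:~R - t j)) (x^~ j) (t j) d d0.
exists (fun l => if l == j then m else k l); split.
  by move=> l; case: eqP => [->|].
have dropj i : \sum_(l <- j :: s)
      x i l * (d * (if l == j then m else k l)%:~R - t l)
    = \sum_(l <- s) x i l * (d * (k l)%:~R - t l) + x i j * (d * m%:~R - t j).
  rewrite big_cons eqxx addrC; congr (_ + _).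
  rewrite big_seq [RHS]big_seq; apply: eq_bigr => l ls.
  by case: eqP => // lj; rewrite -lj ls in js.
under eq_bigr do rewrite dropj.
under [X in _ <= _ * X]eq_bigr do rewrite big_cons.
rewrite big_split/= mulrDr.
by apply: le_trans mx _; rewrite [leRHS]addrC lerD2r.
Qed.

(** Vectors x_i with d^2 |x_i|^2 >= tau^2 are given up, at a cost of one index
    each; the quadratic rounding bound is applied to the other ones only.  For
    these, a margin that drops from 3 tau / 2 below tau forces an error of at
    least tau / 2, and Markov's inequality over the indices counts them. *)
Lemma rounding_keeps_margins (R : realType) n N (x : 'I_N -> 'cV[R]_n)
    (t : 'cV[R]_n) (tau d : R) : 0 < tau -> 0 < d ->
  exists k : 'I_n -> int, (forall j, `|d * (k j)%:~R - t j ord0| <= d) /\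
    \sum_i (3 / 2 * tau <= `|inner (x i) (\col_j (d * (k j)%:~R))|)%R%:R
      <= \sum_i (tau <= `|inner (x i) t|)%R%:R
         + \sum_i Num.min 1 (d ^+ 2 / tau ^+ 2 * inner (x i) (x i)) :> R.
Proof.
move=> tau0 d0.
pose small i := d ^+ 2 / tau ^+ 2 * inner (x i) (x i) < 1.
have [k [kt kx]] := exists_good_rounding_vector R _ _
  (fun i j => if small i then x i j ord0 else 0) (fun j => t j ord0) d d0.
exists k; split=> //.
set theta := \col_j _.
pose e := theta - t.
have xe i : \sum_j (if small i then x i j ord0 else 0)
    * (d * (k j)%:~R - t j ord0) = (small i)%:R * inner (x i) e.
  case: (small i); last by rewrite mul0r big1// => j _; rewrite mul0r.
  by rewrite mul1r; apply: eq_bigr => j _; rewrite !mxE.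
have xx i : \sum_j (if small i then x i j ord0 else 0) ^+ 2
    = (small i)%:R * inner (x i) (x i).
  case: (small i); last by rewrite mul0r big1// => j _; rewrite expr0n.
  by rewrite mul1r; apply: eq_bigr => j _; rewrite expr2.
rewrite (eq_bigr _ (fun i _ => congr1 (fun z => z ^+ 2) (xe i))) in kx.
rewrite (eq_bigr _ (fun i _ => xx i)) in kx.
pose defect i : R := if small i then 4 / tau ^+ 2 * inner (x i) e ^+ 2 else 1.
have split_defect : \sum_i defect i = \sum_i (~~ small i)%:R
    + 4 / tau ^+ 2 * \sum_i ((small i)%:R * inner (x i) e) ^+ 2.
  rewrite mulr_sumr -big_split/=; apply: eq_bigr => i _; rewrite /defect.
  by case: (small i); rewrite ?mul1r ?add0r// mul0r expr0n mulr0 addr0.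
have split_min : \sum_i Num.min 1 (d ^+ 2 / tau ^+ 2 * inner (x i) (x i))
    = \sum_i (~~ small i)%:R
      + d ^+ 2 / tau ^+ 2 * \sum_i (small i)%:R * inner (x i) (x i).
  rewrite mulr_sumr -big_split/=; apply: eq_bigr => i _.
  rewrite minC /Num.min -/(small i).
  by case: (small i); rewrite ?mul1r ?add0r// mul0r mulr0 addr0.
apply: (@le_trans _ _ (\sum_i (tau <= `|inner (x i) t|)%R%:R + \sum_i defect i)).
  rewrite -big_split/=; apply: ler_sum => i _.
  have defect0 : 0 <= defect i.
    by rewrite /defect; case: ifP => // _; rewrite mulr_ge0 ?sqr_ge0// divr_ge0 ?sqr_ge0.
  case: (leP (3 / 2 * tau)) => [big_theta|_]; last by rewrite addr_ge0.
  case: (leP tau) => [_|small_t]; first by rewrite lerDl.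
  rewrite add0r /defect; case: ifP => // _.
  have thetaE : inner (x i) theta = inner (x i) t + inner (x i) e.
    by rewrite -innerDr /e addrC subrK.
  have half_tau : tau / 2 <= `|inner (x i) e|.
    have := le_trans big_theta (eq_ind_r (fun z => `|z| <= _)
      (ler_normD (inner (x i) t) (inner (x i) e)) thetaE).
    by lra.
  rewrite -(real_normK (num_real (inner (x i) e))) mulrAC ler_pdivlMr ?exprn_gt0//.
  by rewrite mul1r; nra.
rewrite lerD2l split_defect split_min lerD2l.
apply: le_trans (ler_wpM2l _ kx) _; first by rewrite divr_ge0 ?sqr_ge0.
rewrite le_eqVlt; apply/orP; left; apply/eqP; field.
by rewrite gt_eqF.
Qed.

(** * Counting the lattice points *)

(** The bound on the l^1 norm of k follows from the Euclidean norm of the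
    rounded point, because |k_j| <= k_j^2 for integers.  This is what makes the net
    small. *)
Lemma rounded_point (R : realType) n (t : 'cV[R]_n) (k : 'I_n -> int) (d : R) :
  unit_sphere n t -> 0 < d -> n%:R * d ^+ 2 <= 256^-1 ->
  (forall j, `|d * (k j)%:~R - t j ord0| <= d) ->
  9 / 16 <= inner (\col_j (d * (k j)%:~R)) (\col_j (d * (k j)%:~R)) /\
  (\sum_j `|k j|)%N%:R <= 4 / d ^+ 2.
Proof.
move=> t1 d0 nd kt.
have tE : \sum_j t j ord0 ^+ 2 = 1.
  by rewrite -(expr1n _ 2) -t1 sqr_enorm; apply: eq_bigr => j _; rewrite expr2.
pose e j := d * (k j)%:~R - t j ord0.
have eE : \sum_j e j ^+ 2 <= 256^-1.
  apply: le_trans nd; rewrite mulr_natl -[n in leRHS]card_ord -sumr_const.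
  apply: ler_sum => j _; rewrite -(real_normK (num_real (e j))).
  by rewrite ler_sqr ?nnegrE ?(ltW d0)//; exact: kt.
have thetaE : inner (\col_j (d * (k j)%:~R)) (\col_j (d * (k j)%:~R))
    = \sum_j (d * (k j)%:~R) ^+ 2.
  by apply: eq_bigr => j _; rewrite !mxE expr2.
split.
  (* Young's inequality with weights 1/16 and 16 *)
  have : \sum_j t j ord0 ^+ 2
      <= 17 / 16 * \sum_j (d * (k j)%:~R) ^+ 2 + 17 * \sum_j e j ^+ 2.
    rewrite !mulr_sumr -big_split/=; apply: ler_sum => j _.
    have := sqr_ge0 (d * (k j)%:~R / 4 + 4 * e j).
    by rewrite /e; nra.
  by rewrite thetaE tE; move: eE; lra.
rewrite ler_pdivlMr ?exprn_gt0// mulrC.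
have le4 : \sum_j (d * (k j)%:~R) ^+ 2 <= 4.
  have : \sum_j (d * (k j)%:~R) ^+ 2
      <= 2 * \sum_j t j ord0 ^+ 2 + 2 * \sum_j e j ^+ 2.
    rewrite !mulr_sumr -big_split/=; apply: ler_sum => j _.
    have := sqr_ge0 (t j ord0 - e j).
    by rewrite /e; nra.
  by rewrite tE; move: eE; lra.
apply: le_trans le4; rewrite natr_sum mulr_sumr; apply: ler_sum => j _.
rewrite exprMn ler_pM2l ?exprn_gt0//.
rewrite natr_absz -(real_normK (num_real ((k j)%:~R : R))) -intr_norm.
rewrite -natr_absz -natrX ler_nat.
by case: `|k j|%N => // m; rewrite expnS leq_pmulr// expn_gt0.
Qed.

Lemma le_bin_expn2 m k : ('C(m, k) <= 2 ^ m)%N.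
Proof.
have [km|mk] := leqP k m; last by rewrite bin_small.
rewrite -[2%N]/(1 + 1)%N expnDn (bigD1 (Ordinal (km : k < m.+1)%N))//=.
by rewrite !exp1n !muln1 leq_addr.
Qed.

(** An integer coordinate is encoded as a difference of two naturals, so that
    integer vectors of bounded l^1 norm correspond to bounded sums of naturals,
    which a binomial coefficient counts. *)
Definition lattice_point (R : realType) n L (d : R)
    (u : (n + n).-tuple 'I_L.+1) : 'cV[R]_n :=
  \col_j (d * ((tnth u (lshift n j) : nat)%:R - (tnth u (rshift n j) : nat)%:R)).

Definition lattice_net n L : {set (n + n).-tuple 'I_L.+1} :=
  [set u : (n + n).-tuple 'I_L.+1 | (\sum_(i <- u) i <= L)%N]%SET.

Lemma card_lattice_net n L : (#|lattice_net n L| <= 2 ^ (n + n + L))%N.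
Proof. by rewrite card_partial_ord_partitions; exact: le_bin_expn2. Qed.

Lemma lattice_netP (R : realType) n L (d : R) (k : 'I_n -> int) :
  (\sum_j `|k j| <= L)%N ->
  exists2 u, u \in lattice_net n L &
    lattice_point R n L d u = \col_j (d * (k j)%:~R).
Proof.
move=> kL.
pose pos j := if 0 <= k j then `|k j|%N else 0%N.
pose neg j := if 0 <= k j then 0%N else `|k j|%N.
pose v (i : 'I_(n + n)) : nat := 
  match fintype.split i with inl j => pos j | inr j => neg j end.
have sumv : (\sum_(i < n + n) v i = \sum_j `|k j|)%N.
  rewrite big_split_ord/= -big_split/=; apply: eq_bigr => j _.
  rewrite /v (unsplitK (inl j)) (unsplitK (inr j)) /pos /neg.
  by case: ifP; rewrite ?addn0 ?add0n.
have vL i : (v i < L.+1)%N.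
  rewrite ltnS; apply: leq_trans kL; rewrite -sumv (bigD1 i)//=.
  exact: leq_addr.
exists [tuple (Ordinal (vL i)) | i < n + n].
  rewrite inE big_tuple; under eq_bigr do rewrite tnth_mktuple/=.
  by rewrite sumv.
apply/colP => j; rewrite !mxE !tnth_mktuple/= /v.
rewrite (unsplitK (inl j)) (unsplitK (inr j)) /pos /neg.
congr (_ * _); case: ifPn => [k0|]; first by rewrite subr0 natr_absz ger0_norm.
by rewrite -ltNge => k0; rewrite sub0r natr_absz ltr0_norm// mulrNz opprK.
Qed.

(** * Measurability of the smallest singular value *)

Lemma measurable_superlevel (R : realType) (d : measure_display)
    (T : measurableType d) (f : T -> R) (a : R) :
  measurable_fun setT f -> measurable [set w | a <= f w].
Proof.
move=> mf; rewrite -[X in measurable X]setTI.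
have -> : [set w | a <= f w] = f @^-1` `[a, +oo[.
  by apply/seteqP; split => w /=; rewrite in_itv/= andbT.
by apply: mf => //; exact: measurable_itv.
Qed.

Lemma measurable_inner_vec (R : realType) n (t : 'cV[R]_n) :
  measurable_fun setT (fun x : n.-tuple R => inner (vec x) t).
Proof.
apply: measurable_sum => j; apply: measurable_funM => //.
under eq_fun do rewrite mxE.
exact: measurable_tnth.
Qed.

Lemma measurable_sqr_vec (R : realType) n :
  measurable_fun setT (fun x : n.-tuple R => inner (vec x) (vec x)).
Proof.
apply: measurable_sum => j; apply: measurable_funM; under eq_fun do rewrite mxE;
  exact: measurable_tnth.
Qed.

Lemma measurable_abs_inner_ge (R : realType) n (t : 'cV[R]_n) (a : R) :
  measurable [set x : n.-tuple R | a <= `|inner (vec x) t|].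
Proof.
apply: measurable_superlevel; apply: measurableT_comp => //.
exact: measurable_inner_vec.
Qed.

Lemma integer_scaling_cvg (R : realType) (s : R) :
  (fun m : nat => m.+1%:R^-1 * (Num.floor (m.+1%:R * s))%:~R : R) @ \oo --> s.
Proof.
apply: (@squeeze_cvgr _ _ _ _ (fun m : nat => s - m.+1%:R^-1) (cst s)).
- near=> m.
  have m0 : 0 < m.+1%:R :> R by [].
  rewrite /= ler_pdivlMl// ler_pdivrMl// floor_le_tmp andbT.
  rewrite mulrBr mulfV ?gt_eqF//.
  by have := floorD1_gt (m.+1%:R * s); rewrite intrD; lra.
- rewrite -[X in _ --> X]subr0; apply: cvgB; first exact: cvg_cst.
  exact: cvg_harmonic.
- exact: cvg_cst.
Unshelve. all: by end_near. Qed.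

(** Both sides are continuous and homogeneous of degree 2, and the directions of
    integer vectors are dense. *)
Lemma quadratic_bound_from_integers (R : realType) n N (G : 'M[R]_(N, n)) (c : R) :
  (forall k : 'cV[int]_n, let z := map_mx intr k : 'cV[R]_n in
    c ^+ 2 * inner z z <= inner (G *m z) (G *m z)) ->
  forall t : 'cV[R]_n, c ^+ 2 * inner t t <= inner (G *m t) (G *m t).
Proof.
move=> Gz t.
pose k m : 'cV[int]_n := \col_j Num.floor (m.+1%:R * t j ord0).
pose z m : 'cV[R]_n := m.+1%:R^-1 *: map_mx intr (k m).
have zt j : (fun m => z m j ord0) @ \oo --> t j ord0.
  under eq_fun do rewrite !mxE.
  exact: integer_scaling_cvg.
have innerzt : (fun m => inner (z m) (z m)) @ \oo --> inner t t.
  by apply: cvg_big => [|j _]; [exact: add_continuous | exact: cvgM].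
have Gzt i : (fun m => (G *m z m) i ord0) @ \oo --> (G *m t) i ord0.
  rewrite mxE; under eq_fun do rewrite mxE.
  apply: cvg_big => [|j _]; first exact: add_continuous.
  by apply: cvgM => //; exact: cvg_cst.
have innerGzt : (fun m => inner (G *m z m) (G *m z m)) @ \oo
    --> inner (G *m t) (G *m t).
  by apply: cvg_big => [|i _]; [exact: add_continuous | exact: cvgM].
apply: (ler_cvg_to (cvgM (cvg_cst (c ^+ 2)) innerzt) innerGzt).
apply: nearW => m /=.
by rewrite /z -scalemxAr !inner_scale mulrCA ler_wpM2l ?sqr_ge0//; exact: Gz.
Qed.

(** A countable family of conditions equivalent to a lower bound on the infimum
    over the sphere. *)
Lemma le_lambda_minP (R : realType) n N (G : 'M[R]_(N, n)) (c : R) :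
  (0 < n)%N -> 0 <= c ->
  c <= lambda_min G <->
  forall k : 'cV[int]_n, let z := map_mx intr k : 'cV[R]_n in
    c ^+ 2 * inner z z <= inner (G *m z) (G *m z).
Proof.
move=> n0 c0; split => [cG k|Gz].
  set z := map_mx _ _ => /=.
  have enormZ p a (v : 'cV[R]_p) : 0 <= a -> enorm (a *: v) = a * enorm v.
    by move=> a0; rewrite /enorm inner_scale sqrtrM ?sqr_ge0// sqrtr_sqr ger0_norm.
  have [z0|zN0] := eqVneq (enorm z) 0.
    by rewrite -(sqr_enorm _ _ z) z0 expr0n mulr0 -sqr_enorm sqr_ge0.
  have zV0 : 0 <= (enorm z)^-1 by rewrite invr_ge0 sqrtr_ge0.
  have Gz : c <= enorm (G *m ((enorm z)^-1 *: z)).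
    apply: le_trans cG _; apply: ge_inf.
      by exists 0 => _ [t _ <-]; exact: sqrtr_ge0.
    exists ((enorm z)^-1 *: z) => //; rewrite /unit_sphere/= enormZ//.
    by rewrite mulVf.
  rewrite -scalemxAr enormZ// ler_pdivlMl in Gz; last by rewrite lt0r zN0 sqrtr_ge0.
  by rewrite -!sqr_enorm -exprMn mulrC ler_sqr ?nnegrE ?mulr_ge0 ?sqrtr_ge0.
apply: lb_le_inf.
  exists (enorm (G *m delta_mx (Ordinal n0) ord0)).
  exists (delta_mx (Ordinal n0) ord0) => //; exact: unit_sphere_delta.
move=> _ [t t1 <-]; rewrite -ler_sqr ?nnegrE ?sqrtr_ge0//.
rewrite sqr_enorm -[leLHS]mulr1 -(expr1n R 2) -t1 sqr_enorm.
exact: quadratic_bound_from_integers.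
Qed.

Lemma measurable_le_lambda_min (R : realType) (d : measure_display)
    (T : measurableType d) (P : probability T R) n N
    (Xs : 'I_N -> {RV P >-> n.-tuple R}) (c : R) :
  (0 < n)%N -> 0 <= c ->
  measurable [set w | c <= lambda_min (Gamma (fun i => Xs i w))].
Proof.
move=> n0 c0.
pose A (k : 'cV[int]_n) := [set w | let z := map_mx intr k : 'cV[R]_n in
  let G := Gamma (fun i => Xs i w) in
  c ^+ 2 * inner z z <= inner (G *m z) (G *m z)].
have -> : [set w | c <= lambda_min (Gamma (fun i => Xs i w))]
    = \bigcap_m (if unpickle m is Some k then A k else setT).
  apply/seteqP; split => w /=.
    by move=> /le_lambda_minP cG m _; case: unpickle => // k; exact: cG.
  move=> Aw; apply/le_lambda_minP => // k.
  by have := Aw (pickle k) I; rewrite pickleK.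
apply: bigcapT_measurable => m; case: unpickle => // k.
apply: measurable_superlevel.
apply: measurable_sum => i.
have mi : measurable_fun setT (fun w =>
    (Gamma (fun j => Xs j w) *m map_mx intr k) i ord0).
  have -> : (fun w => (Gamma (fun j => Xs j w) *m map_mx intr k) i ord0)
      = (fun w => (Num.sqrt N%:R)^-1 * inner (vec (Xs i w)) (map_mx intr k)).
    by apply/funext => w; rewrite Gamma_mulmx.
  by apply: measurable_funM => //; exact: measurableT_comp (measurable_inner_vec _ _ _) _.
exact: measurable_funM.
Qed.

(** * Tail bounds for independent copies *)

Lemma union_bound (R : realType) (d : measure_display) (T : measurableType d)
    (P : probability T R) (I : finType) (D : pred I) (F : I -> set T) :
  (forall i, measurable (F i)) ->
  measurable [set w | exists2 i, D i & F i w] /\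
  (P [set w | exists2 i, D i & F i w] <= \sum_(i | D i) P (F i))%E.
Proof.
move=> mF.
have -> : [set w | exists2 i, D i & F i w] = \big[setU/set0]_(i | D i) F i.
  apply/seteqP; split => w.
    by case=> i Di Fi; rewrite (bigD1 i)//=; left.
  rewrite /=; elim/big_ind: _ => // [A B IHA IHB [/IHA|/IHB]//|i Di Fi].
  by exists i.
elim/big_rec2: _ => [|i y A Di [mA PA]].
  by split; [exact: measurable0 | rewrite measure0].
split; first exact: measurableU.
by apply: le_trans (measureU2 _ _ _) _ => //; rewrite leeD2l.
Qed.

(** Since f takes finitely many values, the event is a finite union of the
    atoms on which all f(X_i) are prescribed.  Independence gives their probabilities
    as products, and weighting each atom by exp(sum h) >= 1 makes the sum factor. *)
Lemma chernoff_iid (R : realType) (d0 d d' : measure_display)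
    (T0 : measurableType d0) (T : measurableType d) (T' : measurableType d')
    (P0 : probability T0 R) (P : probability T R) (N : nat)
    (X : {RV P0 >-> T'}) (Xs : 'I_N -> {RV P >-> T'})
    (K : finType) (f : T' -> K) (h : K -> R) :
  independent_copies X Xs -> (forall k, measurable (f @^-1` [set k])) ->
  measurable [set w | 0 <= \sum_i h (f (Xs i w))] /\
  (P [set w | (0 <= \sum_i h (f (Xs i w)))%R]
    <= ((\sum_k fine (P0 [set w | f (X w) = k]) * expR (h k)) ^+ N)%:E)%E.
Proof.
move=> [indep law] mf.
pose p k := fine (P0 [set w | f (X w) = k]).
have mX k : measurable [set w | f (X w) = k].
  by have := measurable_funPTI X (mf k).
have pE k : P0 [set w | f (X w) = k] = (p k)%:E.
  by rewrite /p fineK// fin_num_measure.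
have p0 k : 0 <= p k by rewrite /p fine_ge0.
pose atom (g : {ffun 'I_N -> K}) : set T :=
  \bigcap_(i in [set` finset.setT]) (Xs i @^-1` (f @^-1` [set g i])).
have matom g : measurable (atom g).
  apply: fin_bigcap_measurable => [|i _]; first exact: finite_finset.
  by have := measurable_funPTI (Xs i) (mf (g i)).
have Patom g : P (atom g) = (\prod_i p (g i))%:E.
  rewrite /atom indep => [|i]; last exact: mf.
  rewrite -prodEFin; apply: eq_big => [i|i _]; first by rewrite inE.
  by have := law i _ (mf (g i)); rewrite -pE.
have -> : [set w | 0 <= \sum_i h (f (Xs i w))]
    = [set w | exists2 g : {ffun 'I_N -> K}, 0 <= \sum_i h (g i) & atom g w].
  apply/seteqP; split => w /=.
    move=> h0; exists [ffun i => f (Xs i w)].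
      by under eq_bigr do rewrite ffunE.
    by move=> i _ /=; rewrite ffunE.
  move=> [g h0 ag]; rewrite (eq_bigr (fun i => h (g i)))// => i _.
  by congr h; apply: ag; rewrite /= inE.
have [mU PU] := union_bound R d T P _ (fun g : {ffun 'I_N -> K} =>
  0 <= \sum_i h (g i)) atom matom.
split=> //; apply: le_trans PU _.
under eq_bigr do rewrite Patom.
rewrite sumEFin lee_fin -[N in _ ^+ N]card_ord -prodr_const bigA_distr_bigA/=.
rewrite [leRHS](bigID (fun g : {ffun 'I_N -> K} => 0 <= \sum_i h (g i)))/=.
rewrite -[leLHS]addr0; apply: lerD.
  apply: ler_sum => g hg; rewrite big_split/= -expR_sum ler_peMr//.
    by apply: prodr_ge0 => i _.
  by rewrite -expR0 ler_expR.
by apply: sumr_ge0 => g _; apply: prodr_ge0 => i _; exact: mulr_ge0 (p0 _) (expR_ge0 _).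
Qed.

Lemma sum_prob_le_expectation (R : realType) (d : measure_display)
    (T : measurableType d) (P : probability T R) (J : finType)
    (a : J -> R) (B : J -> set T) (Y : T -> R) :
  (forall j, 0 <= a j) -> (forall j, measurable (B j)) ->
  measurable_fun setT Y -> (forall w, \sum_j a j * \1_(B j) w <= Y w) ->
  ((\sum_j a j * fine (P (B j)))%:E <= 'E_P[Y])%E.
Proof.
move=> a0 mB mY leY.
have term0 j w : 0 <= a j * \1_(B j) w by rewrite mulr_ge0// indicE.
have mterm j : measurable_fun setT (fun w => a j * \1_(B j) w).
  by apply: measurable_funM => //; exact: measurable_indic.
have sum0 w : 0 <= \sum_j a j * \1_(B j) w by apply: sumr_ge0.
apply: (@le_trans _ _ 'E_P[fun w => (\sum_j a j * \1_(B j) w)%R]%E); last first.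
  apply: expectation_le => //; last by apply: nearW.
  - exact: measurable_sum.
  - by move=> w; apply: le_trans (leY w).
rewrite expectation.unlock; under eq_integral do rewrite -sumEFin.
rewrite ge0_integral_sum//; last 2 first.
- by move=> j; apply/measurable_EFinP.
- by move=> j w _; rewrite lee_fin.
rewrite -sumEFin; apply: lee_sum => j _.
rewrite EFinM fineK ?fin_num_measure//.
under eq_integral do rewrite EFinM.
rewrite ge0_integralZl//; first by rewrite integral_indic// setIT.
- by apply/measurable_EFinP; exact: measurable_indic.
- by rewrite lee_fin.
Qed.

(** The elementary bound exp(z/2) <= 1 / (1 - z/2), squared; the constant 3 is
    what makes it exact for the squared bound at z = 1. *)
Lemma expR_le_chord (R : realType) (z : R) :
  0 <= z <= 1 -> expR z <= 1 + 3 * z.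
Proof.
move=> /andP[z0 z1].
have := expR_ge1Dx (- (z / 2)); rewrite expRN => h.
have e0 := expR_gt0 (z / 2).
have h2 : (1 - z / 2) * expR (z / 2) <= 1.
  by rewrite -ler_pdivlMr// mul1r.
have -> : expR z = expR (z / 2) ^+ 2 by rewrite -expRM_natl; congr expR; field.
have h3 : ((1 - z / 2) * expR (z / 2)) ^+ 2 <= 1.
  by rewrite expr_le1// mulr_ge0 ?expR_ge0//; lra.
have p0 : 0 < (1 - z / 2) ^+ 2 by rewrite exprn_gt0//; lra.
rewrite -(ler_pM2l p0) -exprMn; apply: le_trans h3 _.
have : 0 <= z * (1 - z) * (2 - 3 / 4 * z) by rewrite !mulr_ge0//; lra.
by nra.
Qed.

(** Exponential Markov inequality with parameter 1, using exp(-1) <= 1/2. *)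
Lemma frequency_lower_tail (R : realType) (d0 d d' : measure_display)
    (T0 : measurableType d0) (T : measurableType d) (T' : measurableType d')
    (P0 : probability T0 R) (P : probability T R) (N : nat)
    (X : {RV P0 >-> T'}) (Xs : 'I_N -> {RV P >-> T'}) (f : T' -> bool) (q : R) :
  independent_copies X Xs -> measurable [set x | f x] ->
  q <= fine (P0 [set w | f (X w)]) ->
  measurable [set w | \sum_i (f (Xs i w))%:R <= N%:R * q / 4] /\
  (P [set w | (\sum_i (f (Xs i w))%:R <= N%:R * q / 4)%R]
    <= (expR (- (N%:R * q / 4)))%:E)%E.
Proof.
move=> copies mf qf.
have mfb b : measurable (f @^-1` [set b]).
  case: b; first exact: mf.
  rewrite (_ : _ @^-1` _ = ~` [set x | f x]); first exact: measurableC.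
  by apply/seteqP; split => x /=; [move=> -> | case: (f x)].
have [] := chernoff_iid _ _ _ _ _ _ _ _ _ _ _ _ _ f (fun b => q / 4 - b%:R) copies mfb.
have -> : [set w | 0 <= \sum_i (q / 4 - (f (Xs i w))%:R)]
    = [set w | \sum_i (f (Xs i w))%:R <= N%:R * q / 4].
  apply/seteqP; split => w /=;
  by rewrite sumrB sumr_const card_ord -[X in 0 <= X - _]mulr_natl mulrA subr_ge0.
move=> mS PS; split=> //; apply: le_trans PS _; rewrite lee_fin.
have -> : - (N%:R * q / 4) = N%:R * (- (q / 4)) by ring.
rewrite expRM_natl; apply: lerXn2r; rewrite ?nnegrE ?expR_ge0//.
  by apply: sumr_ge0 => b _; rewrite mulr_ge0 ?expR_ge0 ?fine_ge0.
rewrite big_bool/=.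
set p := fine _; set p' := fine _.
have pE : P0 [set w | f (X w) = true] = p%:E by rewrite /p fineK// fin_num_measure//;
  have := measurable_funPTI X (mfb true).
have p'E : p' = 1 - p.
  rewrite /p' (_ : [set w | f (X w) = false] = ~` [set w | f (X w) = true]).
    rewrite probability_setC ?pE//.
    by have := measurable_funPTI X (mfb true).
  by apply/seteqP; split => x /=; [move=> -> | case: (f (X x))].
have p1 : p <= 1.
  have := @probability_le1 _ _ _ P0 _ (measurable_funPTI X (mfb true)).
  by rewrite -lee_fin -pE.
have qp : q <= p by exact: qf.
have half : expR (q / 4 - 1) <= expR (q / 4) / 2.
  rewrite expRD ler_pM2l ?expR_gt0// expRN lef_pV2 ?posrE ?expR_gt0//.
  by have := expR_ge1Dx (1 : R); lra.
rewrite p'E subr0.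
apply: (@le_trans _ _ (expR (q / 4) * expR (- (p / 2)))); last first.
  by rewrite -expRD ler_expR; lra.
have lin := expR_ge1Dx (- (p / 2)).
have p0 : 0 <= p by rewrite /p fine_ge0.
have e0 := expR_gt0 (q / 4).
apply: (@le_trans _ _ (expR (q / 4) * (1 - p / 2))); last by rewrite ler_pM2l.
by nra.
Qed.

(** The variables min(1, b(X_i)) are rounded down to multiples of 1 / M, with M
    at least 16 / q, to reduce to finitely many values; the total error N / M is at
    most N q / 16.  The event is stated through a measurable superset S of the bad
    set, which is all that the union bound needs. *)
Lemma truncated_mean_upper_tail (R : realType) (d0 d d' : measure_display)
    (T0 : measurableType d0) (T : measurableType d) (T' : measurableType d')
    (P0 : probability T0 R) (P : probability T R) (N : nat)
    (X : {RV P0 >-> T'}) (Xs : 'I_N -> {RV P >-> T'}) (b : T' -> R) (q : R) :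
  independent_copies X Xs -> measurable_fun setT b -> (forall x, 0 <= b x) ->
  0 < q -> ('E_P0[fun w => b (X w)] <= (q / 64)%:E)%E ->
  exists2 S, measurable S /\ (P S <= (expR (- (N%:R * q / 64)))%:E)%E &
    forall w, ~ S w -> \sum_i Num.min 1 (b (Xs i w)) <= N%:R * q / 8.
Proof.
move=> copies mb b0 q0 Eb.
pose M := (Num.trunc (16 / q)).+1.
have M0 : 0 < M%:R :> R by rewrite ltr0n.
have Mq : M%:R^-1 <= q / 16.
  rewrite -[q / 16]invrK lef_pV2 ?posrE ?invr_gt0 ?divr_gt0//.
  by rewrite invf_div ltW// truncnS_gt.
pose level x := minn M (Num.trunc (M%:R * b x)).
pose f x : 'I_M.+1 := inord (level x).
have fE x : f x = level x :> nat by rewrite inordK// ltnS geq_minl.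
have Mb0 x : 0 <= M%:R * b x by rewrite mulr_ge0// ltW.
have mf k : measurable (f @^-1` [set k]).
  have mge j : measurable [set x | j%:R <= M%:R * b x].
    by apply: measurable_superlevel; exact: measurable_funM.
  have mlevel j : measurable [set x | (j <= level x)%N].
    have [jM|Mj] := leqP j M.
      rewrite (_ : mkset _ = [set x | j%:R <= M%:R * b x])//.
      by apply/seteqP; split => x /=; rewrite leq_min jM truncn_ge_nat.
    rewrite (_ : mkset _ = set0)//; apply/seteqP; split => x //=.
    by rewrite leq_min leqNgt Mj.
  rewrite (_ : _ @^-1` _ = [set x | (k <= level x)%N] `\` [set x | (k.+1 <= level x)%N]).
    exact: measurableD.
  apply/seteqP; split => x /=; first by move=> <-; rewrite fE leqnn ltnn.
  by move=> [kx /negP xk]; apply/val_inj/eqP; rewrite /= fE eqn_leq leqNgt xk.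
pose h (k : 'I_M.+1) : R := k%:R / M%:R - q / 16.
have [mS PS] := chernoff_iid _ _ _ _ _ _ _ _ _ _ _ _ _ f h copies mf.
exists [set w | 0 <= \sum_i h (f (Xs i w))]; last first.
  move=> w /negP; rewrite -ltNge => hS.
  have : \sum_i Num.min 1 (b (Xs i w)) <= \sum_i (h (f (Xs i w)) + q / 8).
    apply: ler_sum => i _; rewrite /h fE /level.
    have [TM|MT] := leqP M (Num.trunc (M%:R * b (Xs i w))).
      by rewrite divff ?gt_eqF// ge_min; apply/orP; left; lra.
    rewrite ge_min; apply/orP; right.
    have := truncnS_gt (M%:R * b (Xs i w)).
    rewrite -ltr_pdivlMl// -natr1 mulrDr mulr1 mulrC => ub.
    by lra.
  move=> /le_trans; apply.
  rewrite big_split/= sumr_const card_ord -[X in _ + X]mulr_natl.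
  by move: hS; lra.
split=> //; apply: le_trans PS _; rewrite lee_fin.
have -> : - (N%:R * q / 64) = N%:R * (- (q / 64)) by ring.
rewrite expRM_natl; apply: lerXn2r; rewrite ?nnegrE ?expR_ge0//.
  by apply: sumr_ge0 => k _; rewrite mulr_ge0 ?expR_ge0 ?fine_ge0.
set p := fun k => fine (P0 [set w | f (X w) = k]).
have mB k : measurable [set w | f (X w) = k].
  by have := measurable_funPTI X (mf k).
have p0 k : 0 <= p k by rewrite /p fine_ge0.
have sum_indic (a : 'I_M.+1 -> R) w :
    \sum_k a k * \1_[set v | f (X v) = k] w = a (f (X w)).
  rewrite (bigD1 (f (X w)))//= indicE mem_set// mulr1 big1 ?addr0// => k kf.
  by rewrite indicE memNset ?mulr0//= => fk; rewrite fk eqxx in kf.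
have p1 : \sum_k p k <= 1.
  have := sum_prob_le_expectation _ _ _ P0 _ (fun=> 1)
    (fun k => [set w | f (X w) = k]) (cst 1) (fun=> ler01) mB.
  rewrite expectation_cst lee_fin; under eq_bigr do rewrite mul1r.
  by apply => // w; rewrite (sum_indic (fun=> 1)).
have pk : \sum_(k < M.+1) k%:R / M%:R * p k <= q / 64.
  rewrite -lee_fin; apply: le_trans Eb.
  apply: (sum_prob_le_expectation _ _ _ P0 _ (fun k : 'I_M.+1 => k%:R / M%:R)
    (fun k => [set w | f (X w) = k])) => //.
  - exact: measurableT_comp mb _.
  - move=> w; rewrite (sum_indic (fun k : 'I_M.+1 => k%:R / M%:R)).
    rewrite fE ler_pdivrMr// mulrC -(truncn_ge_nat _ (Mb0 _)).
    exact: geq_minr.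
apply: (@le_trans _ _ (expR (- (q / 16)) * (1 + 3 * (q / 64)))); last first.
  have := expR_ge1Dx (3 * (q / 64)).
  rewrite -(ler_pM2l (expR_gt0 (- (q / 16)))) => /le_trans; apply.
  by rewrite -expRD ler_expR; lra.
apply: (@le_trans _ _ (expR (- (q / 16)) *
    (\sum_k p k + 3 * \sum_(k < M.+1) k%:R / M%:R * p k))); last first.
  by rewrite ler_pM2l ?expR_gt0//; lra.
rewrite mulr_sumr -big_split mulr_sumr/=; apply: ler_sum => k _.
have -> : expR (h k) = expR (- (q / 16)) * expR (k%:R / M%:R).
  by rewrite -expRD addrC.
rewrite mulrCA ler_pM2l ?expR_gt0//.
have -> : p k + 3 * (k%:R / M%:R * p k)
  = p k * (1 + 3 * (k%:R / M%:R)) by ring.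
apply: (ler_wpM2l (p0 k)); apply: expR_le_chord.
rewrite divr_ge0//= ler_pdivrMr// mul1r ler_nat -ltnS.
exact: ltn_ord.
Qed.

(** * Small ball function and second moment *)

(** By homogeneity: theta is a unit vector times a factor of at least 3/4, and
    3/4 * 2 tau = 3/2 tau. *)
Lemma small_ball_le_prob (R : realType) (d : measure_display)
    (T : measurableType d) (P : probability T R) n
    (X : {RV P >-> n.-tuple R}) (theta : 'cV[R]_n) (tau : R) :
  0 < tau -> 9 / 16 <= inner theta theta ->
  Q X (2 * tau) <= fine (P [set w | 3 / 2 * tau <= `|inner (vec (X w)) theta|]).
Proof.
move=> tau0 theta_ge.
have mA a t : measurable [set w | a <= `|inner (vec (X w)) t|].
  by have := measurable_funPTI X (measurable_abs_inner_ge _ _ t a).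
have e34 : 3 / 4 <= enorm theta.
  rewrite -ler_sqr ?nnegrE ?sqrtr_ge0//.
  by rewrite sqr_enorm; apply: le_trans theta_ge; lra.
have e0 : 0 < enorm theta by lra.
pose t := (enorm theta)^-1 *: theta.
have t1 : unit_sphere n t.
  rewrite /unit_sphere/= /enorm inner_scale -sqr_enorm -exprMn mulVf ?gt_eqF//.
  by rewrite expr1n sqrtr1.
apply: (@le_trans _ _ (fine (P [set w | 2 * tau <= `|inner (vec (X w)) t|]))).
  apply: ge_inf; first by exists 0 => _ [u _ <-]; exact: fine_ge0.
  by exists t.
rewrite fine_le ?fin_num_measure// le_measure ?inE// => w /=.
rewrite /t innerZr normrM gtr0_norm ?invr_gt0// ler_pdivlMl//.
by apply: le_trans; nra.
Qed.

Lemma Q_le1 (R : realType) (d : measure_display) (T : measurableType d)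
    (P : probability T R) n (X : {RV P >-> n.-tuple R}) (u : R) :
  Q X u <= 1.
Proof.
have prob_le1 t : fine (P [set w | u <= `|inner (vec (X w)) t|]) <= 1.
  have mS : measurable [set w | u <= `|inner (vec (X w)) t|].
    by have := measurable_funPTI X (measurable_abs_inner_ge _ _ t u).
  by rewrite -lee_fin fineK ?fin_num_measure// probability_le1.
rewrite /Q; set S := (X in inf X).
have [->|/set0P[_ [t t1 _]]] := eqVneq S set0.
  by rewrite inf0.
apply: le_trans (prob_le1 t); apply: ge_inf; last by exists t.
by exists 0 => _ [v _ <-]; exact: fine_ge0.
Qed.

Lemma second_moment_le (R : realType) (d : measure_display)
    (T : measurableType d) (P : probability T R) n
    (X : {RV P >-> n.-tuple R}) (A : R) : 0 < A ->
  ('E_P[fun w => (enorm (vec (X w)) ^+ 2)%R] `^ (2^-1)%R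
     <= (A * Num.sqrt n%:R)%:E)%E ->
  ('E_P[fun w => inner (vec (X w)) (vec (X w))] <= (A ^+ 2 * n%:R)%:E)%E.
Proof.
move=> A0; under eq_fun do rewrite sqr_enorm.
set E := expectation _ _.
have : (0 <= E)%E by apply: expectation_ge0 => w; exact: inner_ge0.
case: E => [r| |]//; last by rewrite poweRyr ?invr_eq0// leye_eq.
rewrite poweR_EFin !lee_fin => r0; rewrite powR12_sqrt// => rA.
rewrite -[r]sqr_sqrtr// -[n%:R]sqr_sqrtr ?ler0n// -exprMn.
by rewrite ler_sqr ?nnegrE ?mulr_ge0 ?sqrtr_ge0// ltW.
Qed.

(** Chebyshev's inequality for each coordinate of X, summed over the
    coordinates.  It forces (2 tau)^2 q <= A^2, hence a mesh small enough for the
    rounded points to keep a norm of at least 3/4. *)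
Lemma small_ball_le_second_moment (R : realType) (d : measure_display)
    (T : measurableType d) (P : probability T R) n
    (X : {RV P >-> n.-tuple R}) (u B : R) : 0 <= u ->
  ('E_P[fun w => inner (vec (X w)) (vec (X w))] <= (B * n%:R)%:E)%E ->
  n%:R * (u ^+ 2 * Q X u) <= B * n%:R.
Proof.
move=> u0 EB.
pose S (j : 'I_n) := [set w | u <= `|inner (vec (X w)) (delta_mx j ord0)|].
have mS j : measurable (S j).
  by have := measurable_funPTI X (measurable_abs_inner_ge _ _ (delta_mx j ord0) u).
apply: (@le_trans _ _ (\sum_(j < n) u ^+ 2 * fine (P (S j)))).
  have -> : n%:R * (u ^+ 2 * Q X u) = \sum_(j < n) u ^+ 2 * Q X u.
    by rewrite sumr_const card_ord mulr_natl.
  apply: ler_sum => j _.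
  rewrite ler_wpM2l ?sqr_ge0//; apply: ge_inf.
    by exists 0 => _ [v _ <-]; exact: fine_ge0.
  by exists (delta_mx j ord0) => //; exact: unit_sphere_delta.
rewrite -lee_fin; apply: le_trans EB.
apply: (sum_prob_le_expectation _ _ _ P _ (fun=> u ^+ 2) S) => //.
- by move=> j; exact: sqr_ge0.
- exact: measurableT_comp (measurable_sqr_vec _ _) _.
- move=> w; apply: ler_sum => j _; rewrite -expr2 indicE.
  have coordE : inner (vec (X w)) (delta_mx j ord0) = vec (X w) j ord0.
    rewrite /inner (bigD1 j)//= big1 => [|i ij].
      by rewrite !mxE !eqxx mulr1 addr0.
    by rewrite [delta_mx _ _ _ _]mxE (negbTE ij) mulr0.
  have [wS|wS] := boolP (w \in S j); last by rewrite mulr0 sqr_ge0.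
  have := set_mem wS; rewrite /S/= coordE => uX.
  rewrite mulr1 -(real_normK (num_real (vec (X w) j ord0))).
  by rewrite ler_sqr ?nnegrE.
Qed.

(** * The lower bound on the smallest singular value *)

Theorem mainTheorem3 (R : realType) :
  exists c1 c2 c3 : R, [/\ 0 < c1, 0 < c2 & 0 < c3] /\
  forall (n N : nat)
    (d0 : measure_display) (T0 : measurableType d0) (P0 : probability T0 R)
    (X : {RV P0 >-> n.-tuple R})
    (d : measure_display) (T : measurableType d) (P : probability T R)
    (Xs : 'I_N -> {RV P >-> n.-tuple R})
    (A tau : R),
  0 < A -> 0 < tau ->
  ('E_P0[fun w => (enorm (vec (X w)) ^+ 2)%R] `^ (2^-1)%R
     <= (A * Num.sqrt n%:R)%:E)%E ->
  0 < Q X (2 * tau) ->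
  independent_copies X Xs ->
  c1 * (A ^+ 2 * n%:R / (tau ^+ 2 * Q X (2 * tau) ^+ 2)) <= N%:R ->
  ((1 - 2 * expR (- (c3 * N%:R * Q X (2 * tau) ^+ 2)))%:E
    <= P [set w | (c2 * tau * Num.sqrt (Q X (2 * tau))
                    <= lambda_min (Gamma (fun i => Xs i w)))%R])%E.
Proof.
exists (64 * 64), 4^-1, 64^-1; split; first by rewrite mulr_gt0 ?invr_gt0 ?ltr0n.
move=> n N d0 T0 P0 X d T P Xs A tau A0 tau0 EX; set q := Q X (2 * tau) => q0.
move=> copies N_large.
have n0 : (0 < n)%N.
  case: (posnP n) => // n_eq0; move: q0; rewrite /q /Q.
  rewrite (_ : image _ _ = set0) ?inf0 ?ltxx//.
  apply/seteqP; split => // y [t]; rewrite /unit_sphere/= /enorm /inner.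
  rewrite big1 => [|j _]; last first.
    by exfalso; have := leq_ltn_trans (leq0n j) (ltn_ord j); rewrite n_eq0.
  by rewrite sqrtr0 => /esym/eqP; rewrite oner_eq0.
have nR0 : 0 < n%:R :> R by rewrite ltr0n.
have q1 : q <= 1 by exact: Q_le1.
have EX2 := second_moment_le _ _ _ _ _ X A A0 EX.
(* This mesh makes the mean of delta^2 |X|^2 / tau^2 at most q / 64. *)
pose delta2 := tau ^+ 2 * q / (64 * A ^+ 2 * n%:R).
have A20 : 0 < A ^+ 2 by rewrite exprn_gt0.
have tau20 : 0 < tau ^+ 2 by rewrite exprn_gt0.
have delta20 : 0 < delta2 by rewrite divr_gt0 ?mulr_gt0.
pose delta := Num.sqrt delta2.
have delta0 : 0 < delta by rewrite sqrtr_gt0.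
have deltaE : delta ^+ 2 = delta2 by rewrite sqr_sqrtr// ltW.
have A_ge : (2 * tau) ^+ 2 * q <= A ^+ 2.
  have tau2_ge0 : 0 <= 2 * tau by lra.
  have := small_ball_le_second_moment _ _ _ _ _ X (2 * tau) (A ^+ 2) tau2_ge0 EX2.
  by rewrite -/q mulrC ler_pM2r.
have n_delta : n%:R * delta ^+ 2 <= 256^-1.
  rewrite deltaE /delta2.
  have -> : n%:R * (tau ^+ 2 * q / (64 * A ^+ 2 * n%:R))
      = 256^-1 * ((2 * tau) ^+ 2 * q / A ^+ 2).
    by field; rewrite !gt_eqF.
  by rewrite ler_piMr ?invr_ge0 ?ler0n// ler_pdivrMr// mul1r.
have N_delta : 64 / delta ^+ 2 <= N%:R * q.
  rewrite deltaE -ler_pdivrMr//; apply: le_trans N_large.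
  rewrite le_eqVlt; apply/orP; left; apply/eqP; rewrite /delta2.
  by field; rewrite !gt_eqF.
have N0 : (0 < N)%N.
  rewrite lt0n; apply/eqP => N_eq0; move: N_delta; rewrite N_eq0 mul0r leNgt.
  by rewrite divr_gt0 ?exprn_gt0.
have Nq0 : 0 <= N%:R * q by rewrite mulr_ge0// ltW.
(* First bad event: some long enough point of the net has too few large
   marginals. *)
pose L := Num.trunc (4 / delta ^+ 2).
pose pt := lattice_point R n L delta.
pose D u := (u \in lattice_net n L) && (9 / 16 <= inner (pt u) (pt u)).
pose marginal u (x : n.-tuple R) := 3 / 2 * tau <= `|inner (vec x) (pt u)|.
pose few u := if D u
  then [set w | \sum_i (marginal u (Xs i w))%:R <= N%:R * q / 4] else set0.
have few_bound u : D u -> measurable (few u) /\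
    (P (few u) <= (expR (- (N%:R * q / 4)))%:E)%E.
  rewrite /few => Du; rewrite Du.
  apply: (frequency_lower_tail _ _ _ _ _ _ _ _ _ _ X) => //.
    exact: measurable_abs_inner_ge.
  by apply: small_ball_le_prob => //; have /andP[] := Du.
have mfew u : measurable (few u).
  have [/few_bound[]//|Du] := boolP (D u).
  by rewrite /few (negbTE Du); exact: measurable0.
have [mE1 PE1] := union_bound R d T P _ D few mfew.
have {}PE1 : (P [set w | exists2 u, D u & few u w]
    <= (expR (- (N%:R * q / 64)))%:E)%E.
  apply: le_trans PE1 _.
  apply: (@le_trans _ _ (\sum_(u in lattice_net n L)
      (expR (- (N%:R * q / 4)))%:E)%E).
    rewrite /D big_mkcondr/=; apply: lee_sum => u u_net; case: ifPn => [u_large|_].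
      by have [] := few_bound u _ => //; rewrite /D u_net.
    by rewrite lee_fin expR_ge0.
  rewrite sumEFin lee_fin sumr_const -[leLHS]mulr_natl.
  apply: (@le_trans _ _ (expR (n + n + L)%:R * expR (- (N%:R * q / 4)))).
    rewrite ler_pM2r ?expR_gt0//.
    apply: (@le_trans _ _ (2 ^ (n + n + L))%:R).
      by rewrite ler_nat card_lattice_net.
    rewrite natrX -[(n + n + L)%:R]mulr1 expRM_natl.
    by apply: lerXn2r; rewrite ?nnegrE ?expR_ge0//; have := expR_ge1Dx (1 : R); lra.
  rewrite -expRD ler_expR !natrD.
  have L_le : L%:R <= 4 / delta ^+ 2 by rewrite truncn_le divr_ge0 ?sqr_ge0.
  have n_le : n%:R <= 256^-1 / delta ^+ 2 by rewrite ler_pdivlMr ?exprn_gt0.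
  have inv_ge0 : 0 <= (delta ^+ 2)^-1 by rewrite invr_ge0 sqr_ge0.
  by move: L_le n_le N_delta inv_ge0; lra.
(* Second bad event: the sample vectors are so long that rounding may lose too
   many margins. *)
pose b (x : n.-tuple R) := delta ^+ 2 / tau ^+ 2 * inner (vec x) (vec x).
have mb : measurable_fun setT b.
  by apply: measurable_funM => //; exact: measurable_sqr_vec.
have ratio0 : 0 <= delta ^+ 2 / tau ^+ 2 by rewrite divr_ge0 ?sqr_ge0.
have b0 x : 0 <= b x by rewrite mulr_ge0 ?inner_ge0.
have Eb : ('E_P0[fun w => b (X w)] <= (q / 64)%:E)%E.
  rewrite expectation.unlock; under eq_integral do rewrite EFinM.
  rewrite ge0_integralZl//; last 2 first.
  - by apply/measurable_EFinP; exact: measurableT_comp (measurable_sqr_vec _ _) _.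
  - by move=> w _; rewrite lee_fin inner_ge0.
  rewrite expectation.unlock in EX2.
  have ratio0E : (0 <= (delta ^+ 2 / tau ^+ 2)%:E)%E by rewrite lee_fin.
  apply: le_trans (lee_wpmul2l ratio0E EX2) _.
  rewrite -EFinM lee_fin le_eqVlt; apply/orP; left; apply/eqP.
  by rewrite deltaE /delta2; field; rewrite !gt_eqF.
have [E2 [mE2 PE2] E2P] := truncated_mean_upper_tail _ _ _ _ _ _ _ _ P _ X Xs b q
  copies mb b0 q0 Eb.
set target := mkset _.
have mtarget : measurable target.
  apply: measurable_le_lambda_min => //.
  by rewrite !mulr_ge0 ?sqrtr_ge0 ?invr_ge0// ltW.
set E1 := mkset _ in mE1 PE1.
have mE : measurable (E1 `|` E2) by exact: measurableU.
have good : ~` (E1 `|` E2) `<=` target.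
  move=> w; rewrite setCU => -[notE1 notE2]; apply: lambda_min_ge => //; first exact: ltW.
  move=> t t1.
  have [k [kt kx]] := rounding_keeps_margins R n N
    (fun i => vec (Xs i w)) t tau delta tau0 delta0.
  have [theta_large kL] := rounded_point R n t k delta t1 delta0 n_delta kt.
  have {}kL : (\sum_j `|k j| <= L)%N.
    by rewrite truncn_ge_nat// divr_ge0 ?sqr_ge0.
  have [u u_net uE] := lattice_netP R n L delta k kL.
  have Du : D u by rewrite /D u_net /pt uE.
  have many : N%:R * q / 4 < \sum_i (marginal u (Xs i w))%:R.
    rewrite ltNge; apply/negP => few_u; apply: notE1; exists u => //.
    by rewrite /few Du.
  have := E2P w notE2; rewrite /b => short.
  move: many kx; rewrite /marginal /pt uE => many kx.
  have := lt_le_trans many kx.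
  by move: short Nq0; lra.
apply: (@le_trans _ _ (P (~` (E1 `|` E2)))); last first.
  by rewrite le_measure ?inE//; exact: measurableC.
rewrite probability_setC// EFinB leeB//.
apply: le_trans (measureU2 _ mE1 mE2) _.
apply: le_trans (leeD PE1 PE2) _; rewrite -EFinD lee_fin.
have : expR (- (N%:R * q / 64)) <= expR (- (64^-1 * N%:R * q ^+ 2)).
  rewrite ler_expR lerN2 expr2.
  have : N%:R * q * q <= N%:R * q by rewrite ler_piMr.
  by lra.
by lra.
Qed.
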